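(* Let $\mathfrak{g}$ be any (finite-dimensional) semisimple Lie algebra and let $k$ be any positive integer. Then there exists an irreducible representation of $\mathfrak{g}$ whose jet-order is greater than $k$.
   Context: Let $\rho:\mathfrak{g}\to\mathfrak{gl}(V)$ be a representation of a finite-dimensional Lie algebra $\mathfrak{g}$ on a vector space $V$. For a subspace $W\subset V$ put $\rho(\mathfrak{g})(W)=\{\rho(x)(w)\mid x\in\mathfrak{g},\ w\in W\}$. A jet-filtration of length $l$ on $\rho$ is an ascending filtration of subspaces $$\{0\}\subsetneq V_1\subsetneq V_2\subsetneq\cdots\subsetneq V_l\subsetneq V$$ satisfying, with $V_{l+1}:=V$, $$V_i\subsetneq\rho(\mathfrak{g})(V_i)\subset V_{i+1}\qquad\text{for } 1\le i\le l.$$ A jet-filtration is maximally refined if no further subspace can be inserted into it so as to obtain a finer jet-filtration. The jet-order of $\rho$ is the maximum of the lengths of all (maximally refined) jet-filtrations on $\rho$. *)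

(* Defs.v *)
From HB Require Import structures.
From mathcomp Require Import all_boot all_order all_algebra.

Set Implicit Arguments.
Unset Strict Implicit.
Unset Printing Implicit Defensive.

Import GRing.Theory.
Local Open Scope ring_scope.

(* Finite-dimensionality is inherited from vectType. *)
HB.mixin Record Vector_isLie (K : fieldType) L of Vector K L := {
  bracket : L -> L -> L;
  bracket_linearl : forall (a : K) (x y z : L),
    bracket (a *: x + y) z = a *: bracket x z + bracket y z;
  bracket_linearr : forall (a : K) (x y z : L),
    bracket x (a *: y + z) = a *: bracket x y + bracket x z;
  bracketxx : forall x : L, bracket x x = 0;
  bracket_jacobi : forall x y z : L,
    bracket x (bracket y z) + bracket y (bracket z x)
      + bracket z (bracket x y) = 0
}.

#[short(type="lieAlgType")]
HB.structure Definition LieAlgebra (K : fieldType) :=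
  { L of Vector_isLie K L & Vector K L }.

Section Semisimple.
Variables (K : fieldType) (g : lieAlgType K).

(* The span of all brackets of elements of A and of B; by bilinearity it is
   enough to bracket the elements of a basis of A with those of a basis of B
   (see bracket_in_bracketv). *)
Definition bracketv (A B : {vspace g}) : {vspace g} :=
  <<[seq bracket x y | x <- vbasis A, y <- vbasis B]>>%VS.

Lemma bracket_in_bracketv (A B : {vspace g}) (x y : g) :
  x \in A -> y \in B -> bracket x y \in bracketv A B.
Proof.
have brl (z : g) : linear (bracket^~ z).
  by move=> a u v; rewrite /= bracket_linearl.
have brr (z : g) : linear (bracket z).
  by move=> a u v; rewrite /= bracket_linearr.
pose fl z := linfun (HB.pack (bracket^~ z : g -> g)
  (GRing.isLinear.Build _ _ _ _ _ (brl z)) : {linear g -> g}).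
pose fr z := linfun (HB.pack (bracket z : g -> g)
  (GRing.isLinear.Build _ _ _ _ _ (brr z)) : {linear g -> g}).
have flE z u : fl z u = bracket u z by rewrite lfunE.
have frE z u : fr z u = bracket z u by rewrite lfunE.
move=> /coord_vbasis -> By; rewrite -flE linear_sum memv_suml // => i _.
rewrite linearZ memvZ //= flE -frE (coord_vbasis By) linear_sum.
apply: memv_suml => j _; rewrite linearZ memvZ //= frE memv_span //.
by apply: allpairs_f; apply: mem_nth; rewrite size_tuple.
Qed.

Definition derived_series (A : {vspace g}) (n : nat) : {vspace g} :=
  iter n (fun B => bracketv B B) A.

Definition solvable_lie (A : {vspace g}) : Prop :=
  exists n, derived_series A n = 0%VS.

Definition lie_ideal (I : {vspace g}) : Prop :=
  forall x y : g, y \in I -> bracket x y \in I.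

(* The zero algebra has zero radical but is excluded, as is customary: a
   semisimple Lie algebra is a direct sum of at least one simple ideal. *)
Definition semisimple_lie : Prop :=
  {:g}%VS <> 0%VS /\
  forall I : {vspace g}, lie_ideal I -> solvable_lie I -> I = 0%VS.

End Semisimple.

Arguments semisimple_lie {K} g.

Section Representations.
Variables (K : fieldType) (g : lieAlgType K) (V : vectType K).

Definition is_lie_rep (rho : 'Hom(g, 'End(V))) : Prop :=
  forall x y : g, rho (bracket x y) = ((rho x \o rho y) - (rho y \o rho x))%VF.

Variable rho : 'Hom(g, 'End(V)).

Definition invariant_subspace (W : {vspace V}) : Prop :=
  forall (x : g) (w : V), w \in W -> rho x w \in W.

Definition irreducible_rep : Prop :=
  [/\ is_lie_rep rho, {:V}%VS <> 0%VS &
      forall W : {vspace V},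
        invariant_subspace W -> W = 0%VS \/ W = {:V}%VS].

(* Membership in {rho(x)(w) | x in g, w in W}: this is the bare set of values,
   not its linear span. *)
Definition rep_image (W : {vspace V}) (v : V) : Prop :=
  exists x : g, exists2 w : V, w \in W & v = rho x w.

Definition proper_subv (U W : {vspace V}) : bool := (U <= W)%VS && (U != W).

(* s = [:: V_1; ...; V_l], of length l = size s.  Since nth defaults to the full
   space, nth {:V} s i is V_(i+1) for every i <= l, including V_(l+1) = V. *)
Definition jet_filtration (s : seq {vspace V}) : Prop :=
  path proper_subv 0%VS (rcons s {:V}%VS) /\
  forall i, (i < size s)%N ->
    [/\ forall v, v \in nth {:V}%VS s i -> rep_image (nth {:V}%VS s i) v,
        exists2 v, rep_image (nth {:V}%VS s i) v & v \notin nth {:V}%VS s i &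
        forall v, rep_image (nth {:V}%VS s i) v -> v \in nth {:V}%VS s i.+1].

Definition maximally_refined (s : seq {vspace V}) : Prop :=
  forall (s1 s2 : seq {vspace V}) (U : {vspace V}),
    s = s1 ++ s2 -> ~ jet_filtration (s1 ++ U :: s2).

(* Dropping the condition maximally_refined gives the same notion, as
   lengths are bounded by dim V and a longest jet-filtration is maximally
   refined. *)
Definition is_jet_order (m : nat) : Prop :=
  (exists s, [/\ jet_filtration s, maximally_refined s & size s = m]) /\
  (forall s, jet_filtration s -> maximally_refined s -> (size s <= m)%N).

End Representations.

(* Main.v *)
(* Some [h] in [[g, g]] has a non-nilpotent adjoint action: otherwise Engel's
   theorem makes [[g, g]], hence [g], solvable.  Let [a <> 0] be an eigenvalue of
   [ad h] in a splitting field [L] of its characteristic polynomial, and let [V] be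
   an irreducible constituent of the [n]-th tensor power of the adjoint
   representation on which [h] has the eigenvalue [n a].  Starting from an
   [h]-stable subspace [W] of dimension at most [dim g], killed by a polynomial
   whose roots are [n] times nonzero eigenvalues of [ad h], put [V_1 = W] and
   [V_(i+1) = V_i + g V_i].  Each [V_i] is [h]-stable, and the eigenvalues of [h]
   on it are [n b + c], where [b <> 0] is an eigenvalue of [ad h] and [c] is a sum
   of at most [i - 1] of them.  Since [L] has characteristic 0, all but finitely
   many [n] make these nonzero for [i <= k + 1], and then [V_i = h V_i]; moreover
   [V_i] is not [g]-stable unless it is [0] or [V].

   It remains to see that [V_(k+1) <> V], which follows once
   [dim V > B = (dim g + 1)^k dim g].  If a representation of dimension [d <= B]
   over [L] is irreducible with [n a] as an eigenvalue of [h], then all its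
   eigenvalues are [n a + c], [c] a sum of at most [d] eigenvalues of [ad h]; as
   [h] has trace zero, [d n a] is minus a sum of at most [d^2] eigenvalues of
   [ad h].  This again excludes only finitely many [n]. *)
Require Import Defs.
From HB Require Import structures.
From mathcomp Require Import all_boot all_order all_algebra all_field.
From Stdlib Require Import Classical.

Set Implicit Arguments.
Unset Strict Implicit.
Unset Printing Implicit Defensive.

Import GRing.Theory VectorInternalTheory.
Local Open Scope ring_scope.

(** * Splitting fields of monic polynomials *)

Lemma irreducible_factor (K : fieldType) (p : {poly K}) : (1 < size p)%N ->
  exists2 q : {poly K}, irreducible_poly q & q %| p.
Proof.
have [n] := ubnP (size p); elim: n p => // n IHn p ltpn p_gt1.
have [irr_p|] := classic (irreducible_poly p); first by exists p.
move=> nirr; have [q [q1 qp nqp]] :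
    exists q : {poly K}, [/\ size q != 1, q %| p & ~~ (q %= p)].
  apply: NNPP => nq; apply: nirr; split=> // q q1 qp.
  by apply/negPn/negP => nqp; apply: nq; exists q.
have p0 : p != 0 by rewrite -size_poly_gt0 ltnW.
have q0 : q != 0 by apply: contraTneq qp => ->; rewrite dvd0p.
have ltqp : (size q < size p)%N.
  by rewrite ltn_neqAle dvdp_leq // andbT dvdp_size_eqp.
have [||r irr_r rq] := IHn q; first exact: leq_trans ltqp _.
  by rewrite ltn_neqAle eq_sym q1 size_poly_gt0.
by exists r; last exact: dvdp_trans rq qp.
Qed.

(** Adjoin a root of an irreducible factor, divide by the linear factor it gives, and repeat over
    the larger field; the induction on the degree lets the field vary. *)
Lemma splitting_field_exists (K : fieldType) (p : {poly K}) : p \is monic ->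
  exists (L : fieldType) (iota : {rmorphism K -> L}) (s : seq L),
    map_poly iota p = \prod_(a <- s) ('X - a%:P).
Proof.
have [n] := ubnP (size p); elim: n K p => // n IHn K p ltpn mon_p.
have p0 := monic_neq0 mon_p.
have [p_le1|p_gt1] := leqP (size p) 1.
  exists K, (GRing.RMorphism.clone _ _ idfun _), [::].
  move: mon_p; rewrite (size1_polyC p_le1) monicE lead_coefC => /eqP ->.
  by rewrite big_nil rmorph1.
have [q irr_q qp] := irreducible_factor p_gt1.
have [L1 _ [z qz _]] := irredp_FAdjoin irr_q.
pose i1 : {rmorphism K -> L1} := GRing.RMorphism.clone _ _ (in_alg L1) _.
have : root (map_poly i1 p) z.
  by apply: root_dvdp qz; rewrite dvdp_map.
case/factor_theorem => p1 Dp.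
have mon_p1 : p1 \is monic.
  by rewrite -(monicMr p1 (monicXsubC z)) -Dp map_monic.
have szp1 : (size p1 < n)%N.
  rewrite -ltnS; apply: leq_trans ltpn; rewrite ltnS -(size_map_poly i1 p) Dp.
  by rewrite size_Mmonic ?monicXsubC ?monic_neq0 // size_XsubC addn2.
have [L [i2 [s Dp1]]] := IHn L1 p1 szp1 mon_p1.
exists L, (GRing.RMorphism.clone _ _ (i2 \o i1) _), (i2 z :: s).
rewrite map_poly_comp Dp rmorphM /= Dp1 big_cons mulrC rmorphB /=.
by rewrite map_polyX map_polyC.
Qed.

(** * Vectors annihilated by products of operators [f - t] *)

Section Killed.
Variable L : fieldType.
Implicit Types (ts ps qs T : seq L).

(** The value at [x] of the monic polynomial in [f] with root list [ts]. *)
Fixpoint prodsub (V : lmodType L) (f : V -> V) ts (x : V) : V :=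
  if ts is t :: ts' then prodsub f ts' (f x - t *: x) else x.

(* Stands for: [x] lies in the sum of the generalized eigenspaces of [f] for the
   eigenvalues in [T]; multiplicities in [ts] are unrestricted. *)
Definition killed (V : lmodType L) (f : V -> V) T (x : V) : Prop :=
  exists2 ts, {subset ts <= T} & prodsub f ts x = 0.

Section Linear.
Variables (V : lmodType L) (f : {linear V -> V}).

Lemma prodsub_is_linear ts : linear (prodsub f ts).
Proof.
elim: ts => //= t ts IH a x y; rewrite -IH; congr (prodsub f ts _).
rewrite linearP scalerDr scalerBr opprD addrACA; congr (_ - _ + _).
by rewrite !scalerA mulrC.
Qed.

Lemma prodsubD ts x y : prodsub f ts (x + y) = prodsub f ts x + prodsub f ts y.
Proof. by have := prodsub_is_linear ts 1 x y; rewrite !scale1r. Qed.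

Lemma prodsub0 ts : prodsub f ts 0 = 0.
Proof. by apply: (addrI (prodsub f ts 0)); rewrite -prodsubD !addr0. Qed.

Lemma prodsubZ ts a x : prodsub f ts (a *: x) = a *: prodsub f ts x.
Proof. by rewrite -[a *: x]addr0 prodsub_is_linear prodsub0 addr0. Qed.

Lemma prodsub_cat ts us x : prodsub f (ts ++ us) x = prodsub f us (prodsub f ts x).
Proof. by elim: ts x => //= t ts IH x. Qed.

Lemma prodsub_comm (g : {linear V -> V}) ts x : (forall y, g (f y) = f (g y)) ->
  g (prodsub f ts x) = prodsub f ts (g x).
Proof.
by move=> gf; elim: ts x => //= t ts IH x; rewrite IH linearB linearZ /= gf.
Qed.

Lemma prodsubC ts us x :
  prodsub f ts (prodsub f us x) = prodsub f us (prodsub f ts x).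
Proof.
elim: ts x => //= t ts IH x; rewrite -IH; congr (prodsub f ts _).
have -> : f (prodsub f us x) = prodsub f us (f x) by apply: prodsub_comm.
by rewrite -scaleNr -prodsubZ -prodsubD scaleNr.
Qed.

Lemma killed0 T : killed f T 0.
Proof. by exists [::]. Qed.

Lemma killedD T x y : killed f T x -> killed f T y -> killed f T (x + y).
Proof.
move=> [ts tsT xts] [us usT yus]; exists (ts ++ us).
  by move=> t; rewrite mem_cat => /orP[/tsT|/usT].
by rewrite prodsubD !prodsub_cat xts prodsubC yus !prodsub0 addr0.
Qed.

Lemma killedZ T a x : killed f T x -> killed f T (a *: x).
Proof. by move=> [ts tsT xts]; exists ts => //; rewrite prodsubZ xts scaler0. Qed.

Lemma killed_sum T (I : Type) (r : seq I) (P : pred I) (F : I -> V) :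
  (forall i, P i -> killed f T (F i)) -> killed f T (\sum_(i <- r | P i) F i).
Proof. by apply: big_ind => [|x y]; [apply: killed0 | apply: killedD]. Qed.

Lemma prodsub_eigen ts s x : f x = s *: x ->
  prodsub f ts x = (\prod_(t <- ts) (s - t)) *: x.
Proof.
elim: ts x => [|t ts IH] x fx /=; first by rewrite big_nil scale1r.
by rewrite fx -scalerBl prodsubZ IH // scalerA big_cons.
Qed.

Lemma killed_eigen T s x : f x = s *: x -> x != 0 -> killed f T x -> s \in T.
Proof.
move=> fx x0 [ts tsT]; rewrite (prodsub_eigen _ fx) => /eqP.
rewrite scaler_eq0 (negPf x0) orbF prodf_seq_eq0 => /hasP[t /tsT tT].
by rewrite /= subr_eq0 => /eqP->.
Qed.

End Linear.

Lemma killed_sub (V : lmodType L) (f : V -> V) T T' x :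
  {subset T <= T'} -> killed f T x -> killed f T' x.
Proof. by move=> sT [ts tsT xts]; exists ts => // t /tsT/sT. Qed.

(* [fW - (p + q)] acts on [b u x] as [fU - p] on [u] plus [fX - q] on [x]. *)
Lemma killed_bilinear (U X W : lmodType L) (fU : {linear U -> U})
    (fX : {linear X -> X}) (fW : {linear W -> W}) (b : U -> X -> W) (T S : seq L) :
    (forall x, linear (b^~ x)) -> (forall u, linear (b u)) ->
    (forall u x, fW (b u x) = b (fU u) x + b u (fX x)) ->
  forall u x, killed fU T u -> killed fX S x ->
  killed fW [seq t + s | t <- T, s <- S] (b u x).
Proof.
move=> bl br fb u x [ps psT ups] [qs qsS xqs].
have bDl x' a u1 u2 : b (u1 - a *: u2) x' = b u1 x' - a *: b u2 x'.
  have := bl x' (- a) u2 u1; rewrite !scaleNr => bl'.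
  by rewrite [u1 - _]addrC bl' addrC.
have bDr u' a x1 x2 : b u' (x1 - a *: x2) = b u' x1 - a *: b u' x2.
  have := br u' (- a) x2 x1; rewrite !scaleNr => br'.
  by rewrite [x1 - _]addrC br' addrC.
have b0l x' : b 0 x' = 0.
  by rewrite -[0 in LHS](subrr u) -[X in u - X]scale1r bDl scale1r subrr.
have b0r u' : b u' 0 = 0.
  by rewrite -[0 in LHS](subrr x) -[X in x - X]scale1r bDr scale1r subrr.
(* Induction on the total number of factors annihilating [u] and [x]; with none left on one side,
   that vector is 0. *)
have [n] := ubnP (size ps + size qs).
elim: n => // n IHn in ps qs psT qsS u x ups xqs *.
case: ps psT ups => [|p ps] psT /= ups.
  by rewrite ups b0l => _; apply: killed0.
case: qs qsS xqs => [|q qs] qsS /= xqs.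
  by rewrite xqs b0r => _; apply: killed0.
rewrite addSn ltnS addnS => len.
have [||ts1 ts1TS kts1] := IHn ps (q :: qs) _ qsS (fU u - p *: u) x ups xqs.
- by move=> t tps; apply: psT; rewrite inE tps orbT.
- by rewrite /= addnS.
have [||ts2 ts2TS kts2] := IHn (p :: ps) qs psT _ u (fX x - q *: x) ups xqs.
- by move=> t tqs; apply: qsS; rewrite inE tqs orbT.
- by rewrite /= addSn.
(* The factor for [p + q] leaves two terms, each with one factor fewer on one side; [ts1] and [ts2]
   annihilate them. *)
exists ((p + q) :: ts1 ++ ts2).
  move=> t; rewrite inE mem_cat => /orP[/eqP->|/orP[/ts1TS|/ts2TS]] //.
  by apply: allpairs_f; [apply: psT|apply: qsS]; rewrite mem_head.
rewrite /= fb; set y := _ - _.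
have -> : y = b (fU u - p *: u) x + b u (fX x - q *: x).
  by rewrite bDl bDr /y scalerDl opprD addrACA.
by rewrite prodsubD !prodsub_cat kts1 prodsubC kts2 !prodsub0 addr0.
Qed.

End Killed.

(** * Eigenvalues and traces of matrices *)

Section KilledMatrix.

Lemma prodsub_map (F L : fieldType) (iota : {rmorphism F -> L}) n
    (H : 'M[F]_n) (ts : seq F) (u : 'rV_n) :
  map_mx iota (prodsub (mulmxr H) ts u) =
  prodsub (mulmxr (map_mx iota H)) (map iota ts) (map_mx iota u).
Proof.
elim: ts u => //= t ts IH u; rewrite IH; congr (prodsub _ _ _).
by rewrite map_mxB map_mxM map_mxZ.
Qed.

Lemma killed_map (F L : fieldType) (iota : {rmorphism F -> L}) n
    (H : 'M[F]_n) (T : seq F) (u : 'rV_n) :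
  killed (mulmxr H) T u ->
  killed (mulmxr (map_mx iota H)) (map iota T) (map_mx iota u).
Proof.
move=> [ts tsT uts]; exists (map iota ts).
  by move=> _ /mapP[t /tsT tT ->]; apply: map_f.
by rewrite -prodsub_map uts map_mx0.
Qed.

Lemma horner_prodsub (F : fieldType) n (H : 'M[F]_n.+1) (ts : seq F) (u : 'rV_n.+1) :
  u *m horner_mx H (\prod_(t <- ts) ('X - t%:P)) = prodsub (mulmxr H) ts u.
Proof.
elim: ts u => [|t ts IH] u; first by rewrite big_nil rmorph1 mulmx1.
rewrite big_cons rmorphM /= -IH mulmxA; congr (_ *m _).
by rewrite rmorphB /= horner_mx_X horner_mx_C mulmxBr mul_mx_scalar.
Qed.

Lemma killed_char_poly (F : fieldType) n (H : 'M[F]_n) (S : seq F) (u : 'rV_n) :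
  char_poly H = \prod_(s <- S) ('X - s%:P) -> killed (mulmxr H) S u.
Proof.
case: n H u => [|n] H u chH; first by rewrite [u]thinmx0; apply: killed0.
by exists S => //; rewrite -horner_prodsub -chH Cayley_Hamilton mulmx0.
Qed.

(** Over a splitting field of the characteristic polynomial the trace is the sum of the roots. Each
    root is an eigenvalue, hence comes from an element of [T], so the sum can be taken back to
    [F]. *)
Lemma trace_killed (F : fieldType) n (H : 'M[F]_n) (T : seq F) :
  (forall u : 'rV_n, killed (mulmxr H) T u) ->
  exists2 s : seq F, {subset s <= T} & size s = n /\ \tr H = \sum_(t <- s) t.
Proof.
move=> kT; case: (posnP n) => [n0|n_gt0].
  exists [::] => //; split; first by rewrite n0.
  by rewrite big_nil /mxtrace big1 // => i; have := ltn_ord i; rewrite {2}n0.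
have [L [iota [s Ds]]] := splitting_field_exists (char_poly_monic H).
have sT : {subset s <= map iota T}.
  move=> a as_; have : eigenvalue (map_mx iota H) a.
    by rewrite eigenvalue_root_char -map_char_poly Ds root_prod_XsubC.
  case/eigenvalueP => v vH v0.
  apply: (@killed_eigen _ _ (mulmxr (map_mx iota H))) v0 _ => //.
  rewrite [v]row_sum_delta; apply: killed_sum => j _; apply: killedZ.
  by rewrite -(map_delta_mx iota); apply: killed_map.
have [s' s'T Ds'] : exists2 s', {subset s' <= T} & s = map iota s'.
  elim: (s) sT => [|a t IH] sT; first by exists [::].
  have /mapP[b bT ->] := sT a (mem_head _ _).
  have [|t' t'T ->] := IH; first by move=> c ct; apply: sT; rewrite inE ct orbT.
  by exists (b :: t') => // c; rewrite inE => /orP[/eqP->|/t'T].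
exists s' => //.
have szs : size s = n.
  have := congr1 (fun p : {poly L} => size p) Ds.
  by rewrite size_map_poly size_char_poly size_prod_XsubC => -[].
split; first by rewrite -szs Ds' size_map.
apply: (fmorph_inj iota); apply: oppr_inj; rewrite -rmorphN.
rewrite -char_poly_trace // -coef_map Ds -szs coefPn_prod_XsubC; last first.
  by rewrite szs -lt0n.
by rewrite Ds' big_map rmorph_sum.
Qed.

End KilledMatrix.

Lemma maximal_exists (T : Type) (P : T -> Prop) (f : T -> nat) N :
  (exists x, P x) -> (forall x, P x -> (f x <= N)%N) ->
  exists2 x, P x & forall y, P y -> (f y <= f x)%N.
Proof.
move=> [x Px] fN; have [n] := ubnP (N - f x)%N.
elim: n x Px => // n IHn x Px lt_n.
have [[y Py lt_xy]|max_x] := classic (exists2 y, P y & (f x < f y)%N).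
  apply: (IHn y Py); rewrite -ltnS; apply: leq_trans lt_n; rewrite ltnS.
  by apply: ltn_sub2l => //; apply: leq_trans lt_xy (fN y Py).
exists x => // y Py; rewrite leqNgt; apply/negP => lt_xy.
by apply: max_x; exists y.
Qed.

(** * Engel's theorem and elements with non-nilpotent adjoint action *)

Section LieAlgebra.
Variables (K : fieldType) (g : lieAlgType K).
Implicit Types (x y z : g) (D M U W : {vspace g}).

HB.instance Definition _ x :=
  GRing.isLinear.Build K g g _ (bracket x) (fun a y z => bracket_linearr a x y z).

Lemma bracketDl x y z : bracket (x + y) z = bracket x z + bracket y z.
Proof. by have := bracket_linearl 1 x y z; rewrite !scale1r. Qed.

Lemma bracket0l z : bracket 0 z = 0.
Proof. by apply: (addrI (bracket 0 z)); rewrite -bracketDl !addr0. Qed.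

Lemma bracketZl a x z : bracket (a *: x) z = a *: bracket x z.
Proof. by rewrite -[a *: x]addr0 bracket_linearl bracket0l addr0. Qed.

Lemma bracketC x y : bracket y x = - bracket x y.
Proof.
apply/eqP; rewrite -addr_eq0; apply/eqP; have := bracketxx (x + y).
by rewrite bracketDl !linearD /= !bracketxx add0r addr0 addrC.
Qed.

Lemma bracketA x y z :
  bracket (bracket x y) z = bracket x (bracket y z) - bracket y (bracket x z).
Proof.
have := bracket_jacobi x y z.
rewrite (bracketC (bracket x y)) (bracketC x z) linearN /= => /eqP.
by rewrite addr_eq0 opprK => /eqP.
Qed.

Lemma bracketv_sub U W M :
  (forall x y, x \in U -> y \in W -> bracket x y \in M) -> (bracketv U W <= M)%VS.
Proof.
move=> UWM; apply/span_subvP => _ /allpairsP[[x y] /= [xU yW ->]].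
by apply: UWM; apply: vbasis_mem.
Qed.

Lemma derived_seriesS U W n : (U <= W)%VS ->
  (derived_series U n <= derived_series W n)%VS.
Proof.
rewrite /derived_series => UW; elim: n => //= n IHn.
apply: bracketv_sub => x y xU yU.
by apply: bracket_in_bracketv; apply: (subvP IHn).
Qed.

(** The derived series of [D], shifted by one, lies below that of [M]. *)
Lemma solvable_ext D M : (bracketv D D <= M)%VS -> solvable_lie M -> solvable_lie D.
Proof.
move=> DM [n Mn]; exists n.+1; rewrite /derived_series iterSr.
by apply/eqP; rewrite -subv0 -Mn derived_seriesS.
Qed.

Definition subalgebra D := forall x y, x \in D -> y \in D -> bracket x y \in D.

Definition stabilizes D U := forall x y, x \in D -> y \in U -> bracket x y \in U.

Lemma last_nonmember (f : g -> g) U y :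
  y \notin U -> (exists N, iter N f y \in U) ->
  exists n, iter n f y \notin U /\ iter n.+1 f y \in U.
Proof.
move=> yU [N]; elim: N => [|N IHN]; first by rewrite (negPf yU).
have [/IHN//|NU] := boolP (iter N f y \in U).
by move=> NU'; exists N.
Qed.

(* Engel's theorem for the adjoint action, on all subquotients [W / U] at once;
   solvability follows since the induction exhibits an ideal of codimension one. *)
Lemma engel D : subalgebra D ->
    (forall x y, x \in D -> exists N, iter N (bracket x) y = 0) ->
  solvable_lie D /\
  forall U W, (U <= W)%VS -> U <> W -> stabilizes D U -> stabilizes D W ->
    exists2 y, y \in W /\ y \notin U & forall x, x \in D -> bracket x y \in U.
Proof.
have [n] := ubnP (\dim D); elim: n D => // n IHn D ltDn subD nilD.
have out U W : (U <= W)%VS -> U <> W -> exists2 y, y \in W & y \notin U.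
  move=> UW neqUW; apply: NNPP => nex; apply: neqUW; apply/eqP.
  rewrite eqEsubv UW /=; apply/subvP => y yW; apply: NNPP => /negP yU.
  by apply: nex; exists y.
have [D0|Dn0] := eqVneq D 0%VS.
  split; first by exists 0; rewrite D0.
  move=> U W UW neqUW _ _; have [y yW yU] := out U W UW neqUW.
  by exists y => // x; rewrite D0 memv0 => /eqP->; rewrite bracket0l mem0v.
pose P M := [/\ (M <= D)%VS, M <> D & subalgebra M].
have [||M [MD neqMD subM] maxM] := @maximal_exists _ P (fun M => \dim M) (\dim D).
- exists 0%VS; split; [exact: sub0v | by move/esym/eqP; apply/negP |].
  by move=> x y; rewrite !memv0 => /eqP-> _; rewrite bracket0l.
- by move=> M [MD _ _]; apply: dimvS.
have ltMn : (\dim M < n)%N.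
  apply: leq_trans (_ : \dim M < \dim D)%N ltDn; rewrite ltn_neqAle dimvS // andbT.
  by apply/negP => dimM; apply: neqMD; apply/eqP; rewrite eqEdim MD (eqP dimM) /=.
have nilM x y : x \in M -> exists N, iter N (bracket x) y = 0.
  by move=> xM; apply: nilD; apply: (subvP MD).
have [solM nullM] := IHn M ltMn subM nilM.
(* [M] is a maximal proper subalgebra. The induction hypothesis for [M] acting on [D / M] gives [z]
   outside [M] that normalizes [M]; then [M + <[z]>] is a subalgebra, equal to [D] by maximality. *)
have [|z [zD zM] Mz] := nullM M D MD neqMD subM.
  by move=> x y xM yD; apply: subD => //; apply: (subvP MD).
have zM' x : x \in M -> bracket z x \in M.
  by move=> xM; rewrite bracketC memvN Mz.
have DE : D = (M + <[z]>)%VS.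
  apply: NNPP => neqD.
  have /maxM : P (M + <[z]>)%VS.
    split; first by rewrite subv_add MD -memvE.
      by move=> E; apply: neqD; rewrite E.
    move=> x y /memv_addP[x1 x1M [_ /vlineP[a ->] ->]].
    move=> /memv_addP[y1 y1M [_ /vlineP[b ->] ->]].
    rewrite bracketDl bracketZl !linearD !linearZ /= bracketxx !scaler0 addr0.
    apply: (subvP (addvSl _ _)).
    by do ?apply: memvD; do ?apply: memvZ; do [exact: subM | exact: Mz | exact: zM'].
  move=> dimM; case/negP: zM; rewrite memvE.
  have /eqP -> : M == (M + <[z]>)%VS by rewrite eqEdim addvSl.
  exact: addvSr.
split.
  apply: solvable_ext solM; apply: bracketv_sub => x y.
  rewrite DE => /memv_addP[x1 x1M [_ /vlineP[a ->] ->]].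
  move=> /memv_addP[y1 y1M [_ /vlineP[b ->] ->]].
  rewrite bracketDl bracketZl !linearD !linearZ /= bracketxx !scaler0 addr0.
  by do ?apply: memvD; do ?apply: memvZ; do [exact: subM | exact: Mz | exact: zM'].
move=> U W UW neqUW stU stW.
have [||w [wW wU] Mw] := nullM U W UW neqUW.
- by move=> x y xM; apply: stU; apply: (subvP MD).
- by move=> x y xM; apply: stW; apply: (subvP MD).
(* As [z] normalizes [M] and stabilizes [U], it preserves the vectors of [W] that [M] sends into
   [U]; the last iterate outside [U] is then sent into [U] by all of [D]. *)
have iterP m : iter m (bracket z) w \in W /\
    forall x, x \in M -> bracket x (iter m (bracket z) w) \in U.
  elim: m => //= m [IHW IHM]; split; first exact: stW.
  move=> x xM; have -> : bracket x (bracket z (iter m (bracket z) w)) =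
    bracket (bracket x z) (iter m (bracket z) w)
      + bracket z (bracket x (iter m (bracket z) w)) by rewrite bracketA subrK.
  apply: memvD; first by apply: IHM; apply: Mz.
  by apply: stU zD _; apply: IHM.
have [|m [mU mU']] := @last_nonmember (bracket z) U w wU.
  by have [N zN] := nilD z w zD; exists N; rewrite zN mem0v.
have [mW mM] := iterP m.
exists (iter m (bracket z) w) => // x.
rewrite DE => /memv_addP[x1 x1M [_ /vlineP[a ->] ->]].
by rewrite bracketDl bracketZl; apply: memvD; [exact: mM | exact/memvZ/mU'].
Qed.

(** The choice of [h] in [[g, g]] makes its trace vanish in every finite-dimensional
    representation. *)
Lemma semisimple_nonnilpotent : semisimple_lie g ->
  exists2 h, h \in bracketv {:g} {:g} &
    exists y, forall N, iter N (bracket h) y <> 0.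
Proof.
move=> [g0 rad0]; apply: NNPP => nex; apply: g0.
apply: rad0 => [x y _|]; first exact: memvf.
apply: (@solvable_ext _ (bracketv {:g} {:g})) => //.
have subD x y : bracket x y \in bracketv {:g} {:g}.
  by apply: bracket_in_bracketv; apply: memvf.
apply: (proj1 (engel _ _)) => [x y _ _|x y xD]; first exact: subD.
apply: NNPP => nN; apply: nex; exists x => //; exists y => N N0.
by apply: nN; exists N.
Qed.

End LieAlgebra.

(** * Matrix representations over an extension field and their tensor products *)

Section MatrixRep.
Variables (K F : fieldType) (iota : {rmorphism K -> F}) (g : lieAlgType K).
Implicit Types (x y h : g).

(* Representations act on row vectors on the right, which reverses the order of
   the factors in the commutator. *)
Definition is_mxrep n (R : g -> 'M[F]_n) : Prop :=
  (forall a x y, R (a *: x + y) = iota a *: R x + R y) /\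
  (forall x y, R (bracket x y) = R y *m R x - R x *m R y).

Definition mxirreducible n (R : g -> 'M[F]_n) : Prop :=
  forall W : {vspace 'rV[F]_n},
    (forall x w, w \in W -> w *m R x \in W) -> W = 0%VS \/ W = {:'rV[F]_n}%VS.

Definition lie_basis (i : 'I_(dim g)) : g := r2v (delta_mx 0 i).

Section Rep.
Variables (n : nat) (R : g -> 'M[F]_n).
Hypothesis repR : is_mxrep R.

Lemma mxrepD x y : R (x + y) = R x + R y.
Proof. by have := proj1 repR 1 x y; rewrite rmorph1 !scale1r. Qed.

Lemma mxrep0 : R 0 = 0.
Proof. by apply: (addrI (R 0)); rewrite -mxrepD !addr0. Qed.

Lemma mxrep_sum (I : Type) (r : seq I) (a : I -> K) (f : I -> g) :
  R (\sum_(i <- r) a i *: f i) = \sum_(i <- r) iota (a i) *: R (f i).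
Proof.
elim: r => [|i r IH]; first by rewrite !big_nil mxrep0.
by rewrite !big_cons (proj1 repR) IH.
Qed.

Lemma lie_basisE x : x = \sum_i v2r x 0 i *: lie_basis i.
Proof.
rewrite -[LHS]v2rK [X in r2v X]row_sum_delta linear_sum /=.
by apply: eq_bigr => i _; rewrite linearZ.
Qed.

Lemma mxrep_basisE x : R x = \sum_i iota (v2r x 0 i) *: R (lie_basis i).
Proof. by rewrite {1}[x]lie_basisE mxrep_sum. Qed.

Lemma mxtrace_bracketv h : h \in bracketv {:g} {:g} -> \tr (R h) = 0.
Proof.
move=> /(coord_span (X := in_tuple _))->; rewrite mxrep_sum raddf_sum big1 // => i _.
rewrite /= mxtraceZ; have := mem_nth 0 (ltn_ord i).
case/allpairsP => -[x y] /= [_ _ ->].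
by rewrite (proj2 repR) raddfB /= mxtrace_mulC subrr mulr0.
Qed.

End Rep.

Definition ad_mx x : 'M[K]_(dim g) := lin1_mx (v2r \o bracket x \o r2v).

Lemma ad_mxE x y : v2r y *m ad_mx x = v2r (bracket x y).
Proof. by rewrite mul_rV_lin1 /= v2rK. Qed.

(** [h] acts on [u *m R x] by the Leibniz rule: by [R h] on [u] and by the commutator with [R h] on
    [R x]. On the matrices [R x] this commutator is induced by [ad h], whose eigenvalues are in
    [S]. *)
Lemma killed_mxrep n (R : g -> 'M[F]_n) h S T (u : 'rV_n) x : is_mxrep R ->
    map_poly iota (char_poly (ad_mx h)) = \prod_(s <- S) ('X - s%:P) ->
  killed (mulmxr (R h)) T u ->
  killed (mulmxr (R h)) [seq t + s | t <- T, s <- S] (u *m R x).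
Proof.
move=> repR DS uT.
pose D := map_mx iota (ad_mx h).
pose ad := mulmxr (R h) \- mulmx (R h) : {linear 'M_n -> 'M_n}.
apply: (@killed_bilinear _ _ _ _ (mulmxr (R h)) ad (mulmxr (R h)) mulmx T S _ _ _ _ _ uT).
- by move=> X a u1 u2; rewrite mulmxDl scalemxAl.
- by move=> v a X1 X2; rewrite mulmxDr scalemxAr.
- by move=> v X; rewrite /= mulmxBr !mulmxA addrCA subrr addr0.
(* [ext] extends [R] to [g] with scalars in [F] and turns [ad h] into the commutator, so the
   polynomial that the Cayley-Hamilton theorem gives for [ad h] also annihilates [R x]. *)
pose ext (v : 'rV[F]_(dim g)) := \sum_i v 0 i *: R (lie_basis i).
have ext_lin a v w : ext (v - a *: w) = ext v - a *: ext w.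
  rewrite /ext scaler_sumr -sumrB; apply: eq_bigr => i _.
  by rewrite !mxE scalerBl scalerA.
have adE v : ad (ext v) = ext (v *m D).
  rewrite /ext linear_sum.
  transitivity (\sum_i v 0 i *: \sum_j D i j *: R (lie_basis j)).
    apply: eq_bigr => i _; rewrite linearZ; congr (_ *: _).
    rewrite /= -(proj2 repR) (mxrep_basisE repR); apply: eq_bigr => j _; congr (_ *: _).
    by rewrite -ad_mxE r2vK -rowE !mxE.
  rewrite (eq_bigr (fun i => \sum_j (v 0 i * D i j) *: R (lie_basis j))).
    by rewrite exchange_big; apply: eq_bigr => j _; rewrite mxE scaler_suml.
  by move=> i _; rewrite scaler_sumr; apply: eq_bigr => j _; rewrite scalerA.
have -> : R x = ext (map_mx iota (v2r x)).
  by rewrite (mxrep_basisE repR); apply: eq_bigr => i _; rewrite mxE.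
have [|ts tsS] := @killed_char_poly _ _ D S (map_mx iota (v2r x)).
  by rewrite -map_char_poly.
set v := map_mx _ _ => v0; exists ts => //.
have : ext (prodsub (mulmxr D) ts v) = 0.
  by rewrite v0 /ext big1 // => i _; rewrite mxE scale0r.
by elim: ts v {tsS v0} => //= t ts IH v /IH; rewrite ext_lin -adE.
Qed.

(** The tensor product is realised on [m] by [n] matrices, with [u^T *m v] for the tensor of [u] and
    [v]; the two summands are the Leibniz rule. *)
Definition tensor_mx m n (R1 : g -> 'M[F]_m) (R2 : g -> 'M[F]_n) x : 'M[F]_(m * n) :=
  lin_mx (mulmx (R1 x)^T \+ mulmxr (R2 x)).

Lemma tensor_mxrep m n (R1 : g -> 'M[F]_m) (R2 : g -> 'M[F]_n) :
  is_mxrep R1 -> is_mxrep R2 -> is_mxrep (tensor_mx R1 R2).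
Proof.
move=> rep1 rep2; have eq_mx p (A B : 'M[F]_(m * n, p)) :
    (forall X : 'M_(m, n), mxvec X *m A = mxvec X *m B) -> A = B.
  by move=> AB; apply/row_matrixP => i; rewrite !rowE -[delta_mx 0 i]vec_mxK.
split=> [a x y|x y]; apply: eq_mx => X.
  rewrite mulmxDr -scalemxAr !mul_vec_lin /= (proj1 rep1) (proj1 rep2).
  rewrite -linearZ -linearD /=; congr mxvec.
  rewrite linearD linearZ /= mulmxDl mulmxDr -scalemxAl -scalemxAr scalerDr.
  by rewrite addrACA.
rewrite mulmxBr !mulmxA !mul_vec_lin /= (proj2 rep1) (proj2 rep2) -linearB /=.
congr mxvec; rewrite linearB /= !trmx_mul mulmxBl mulmxBr.
rewrite !mulmxDr !mulmxDl !mulmxA !opprD.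
set a := _ *m _ *m X; set b := _ *m _ *m X; set c := X *m _ *m _.
set d := X *m _ *m _; set e := _ *m _ *m _; set f := _ *m _ *m _.
have -> : a + e + (f + c) + (- b - f + (- e - d)) =
          a - b + (c - d) + ((e - e) + (f - f)).
  by rewrite [LHS](AC ((2*2)*(2*2)) ((1*5)*(4*8)*((2*7)*(3*6)))).
by rewrite !subrr !addr0.
Qed.

End MatrixRep.

(** * Eigenvalues and characteristic polynomials under tensor products, conjugation and block
    decomposition *)

Lemma tensor_eigenvalue (F L : fieldType) (j : {rmorphism F -> L}) m n
    (A : 'M[F]_m) (B : 'M[F]_n) a b :
  eigenvalue (map_mx j A) a -> eigenvalue (map_mx j B) b ->
  eigenvalue (map_mx j (lin_mx (mulmx A^T \+ mulmxr B))) (a + b).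
Proof.
move=> /eigenvalueP[u uA u0] /eigenvalueP[v vB v0].
rewrite (map_lin_mx (gf := mulmx (map_mx j A)^T \+ mulmxr (map_mx j B))); last first.
  by move=> X; rewrite /= map_mxD !map_mxM map_trmx.
apply/eigenvalueP; exists (mxvec (u^T *m v)).
  rewrite mul_vec_lin -linearZ /=; congr mxvec.
  rewrite mulmxA -trmx_mul uA -mulmxA vB linearZ /= -scalemxAl -scalemxAr.
  by rewrite scalerDl.
rewrite mxvec_eq0; have /rV0Pn[i ui] := u0; have /rV0Pn[k vk] := v0.
apply/eqP => /matrixP/(_ i k)/eqP; rewrite !mxE big_ord1 !mxE mulf_eq0.
by rewrite (negPf ui) (negPf vk).
Qed.

Lemma char_poly_conj (F : fieldType) n (E A : 'M[F]_n) : E \in unitmx ->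
  char_poly (E *m A *m invmx E) = char_poly A.
Proof.
move=> uE; pose Ep := map_mx polyC E; pose E'p := map_mx polyC (invmx E).
have EE' : Ep *m E'p = 1%:M by rewrite -map_mxM mulmxV // map_mx1.
rewrite /char_poly.
have -> : char_poly_mx (E *m A *m invmx E) = Ep *m char_poly_mx A *m E'p.
  rewrite /char_poly_mx mulmxBr mulmxBl !map_mxM; congr (_ - _).
  by rewrite mul_mx_scalar -scalemxAl EE' scale_scalar_mx mulr1.
by rewrite !det_mulmx mulrAC -det_mulmx EE' det1 mul1r.
Qed.

Lemma char_poly_lblock (F : fieldType) m1 m2 (A : 'M[F]_(m1 + m2)) :
  ursubmx A = 0 -> char_poly A = char_poly (ulsubmx A) * char_poly (drsubmx A).
Proof.
move=> A0; rewrite -[in LHS](submxK A) A0 /char_poly.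
rewrite -(det_lblock _ (- map_mx polyC (dlsubmx A))).
congr (\det _); rewrite /char_poly_mx map_block_mx map_mx0 scalar_mx_block.
by rewrite opp_block_mx add_block_mx !subr0 sub0r.
Qed.

(** Takes a basis of [W] as the rows of a matrix, which [row_ebase] can complete to a basis of the
    whole space. *)
Lemma vspace_row_free (F : fieldType) n (W : {vspace 'rV[F]_n}) :
  exists2 M : 'M[F]_(\dim W, n), row_free M & forall v, (v <= M)%MS = (v \in W).
Proof.
pose M := \matrix_(i < \dim W) (vbasis W)`_i.
have ME v : v *m M = \sum_i v 0 i *: (vbasis W)`_i.
  by rewrite mulmx_sum_row; apply: eq_bigr => i _; rewrite rowK.
exists M.
  apply: inj_row_free => v; rewrite ME => v0; apply/rowP => i; rewrite mxE.
  by have /freeP/(_ (fun i => v 0 i) v0) := basis_free (vbasisP W).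
move=> v; apply/submxP/idP => [[D ->]|vW].
  rewrite ME; apply: memv_suml => i _; apply: memvZ.
  by apply: vbasis_mem; apply: mem_nth; rewrite size_tuple.
exists (\row_i coord (vbasis W) i v).
rewrite ME [LHS](coord_vbasis vW); apply: eq_bigr => i _.
by rewrite mxE.
Qed.

Lemma dim_rowv (F : fieldType) n : \dim {:'rV[F]_n} = n.
Proof. by rewrite dimvf; apply: mul1n. Qed.

(** * Irreducible constituents of a matrix representation *)

Section Constituent.
Variables (K F : fieldType) (iota : {rmorphism K -> F}) (g : lieAlgType K).

Lemma mxrep_conj n (R : g -> 'M[F]_n) (E : 'M[F]_n) : E \in unitmx ->
  is_mxrep iota R -> is_mxrep iota (fun x => E *m R x *m invmx E).
Proof.
move=> uE [linR brR]; split=> [a x y|x y].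
  by rewrite linR mulmxDr mulmxDl -scalemxAr -scalemxAl.
by rewrite brR mulmxBr mulmxBl !mulmxA !(mulmxKV uE).
Qed.

(** With row vectors, the first [m1] coordinates span a stable subspace; the diagonal blocks are the
    actions on it and on the quotient. *)
Lemma mxrep_lblock m1 m2 (R : g -> 'M[F]_(m1 + m2)) :
    is_mxrep iota R -> (forall x, ursubmx (R x) = 0) ->
  is_mxrep iota (fun x => ulsubmx (R x)) /\ is_mxrep iota (fun x => drsubmx (R x)).
Proof.
move=> [linR brR] R0.
have mulR x y : R x *m R y = block_mx (ulsubmx (R x) *m ulsubmx (R y)) 0
    (dlsubmx (R x) *m ulsubmx (R y) + drsubmx (R x) *m dlsubmx (R y))
    (drsubmx (R x) *m drsubmx (R y)).
  rewrite -{1}(submxK (R x)) -{1}(submxK (R y)) !R0 mulmx_block.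
  by rewrite !mul0mx !mulmx0 !addr0 !add0r.
have ulB (A B : 'M[F]_(m1 + m2)) : ulsubmx (A - B) = ulsubmx A - ulsubmx B.
  by rewrite /ulsubmx !linearB.
have drB (A B : 'M[F]_(m1 + m2)) : drsubmx (A - B) = drsubmx A - drsubmx B.
  by rewrite /drsubmx !linearB.
split; split=> [a x y|x y].
- by rewrite linR /ulsubmx !(linearD, linearZ).
- by rewrite brR ulB !mulR !block_mxKul.
- by rewrite linR /drsubmx !(linearD, linearZ).
- by rewrite brR drB !mulR !block_mxKdr.
Qed.

(* [P] is the property of having a given eigenvalue, possibly over an extension
   field. *)
Lemma irreducible_constituent (h : g) (P : {poly F} -> Prop) n (R : g -> 'M[F]_n) :
    (forall p q, P (p * q) -> P p \/ P q) -> ~ P 1 ->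
    is_mxrep iota R -> P (char_poly (R h)) ->
  exists m (R' : g -> 'M[F]_m), [/\ (0 < m <= n)%N, is_mxrep iota R',
    mxirreducible R' & P (char_poly (R' h))].
Proof.
move=> PM P1; have [N] := ubnP n; elim: N n R => // N IHN n R ltnN repR PR.
have [irrR|redR] := classic (mxirreducible R).
  (* The dimension is positive because the empty matrix has characteristic polynomial 1. *)
  exists n, R; split=> //; rewrite leqnn andbT lt0n; apply/eqP => n0.
  move: PR; rewrite /char_poly; move: (char_poly_mx _).
  by rewrite n0 => A; rewrite det_mx00.
have [W [stW W0 Wfull]] : exists W : {vspace 'rV[F]_n},
    [/\ forall x w, w \in W -> w *m R x \in W, W <> 0%VS & W <> fullv].
  apply: NNPP => nex; apply: redR => W stW; apply: NNPP => nW; apply: nex; exists W.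
  by split=> // WE; apply: nW; [left|right].
have [M freeM ME] := vspace_row_free W.
have W_gt0 : (0 < \dim W)%N by rewrite lt0n dimv_eq0; apply/eqP.
have Wltn : (\dim W < n)%N.
  have := dimvS (subvf W); rewrite dim_rowv ltn_neqAle => ->; rewrite andbT.
  apply/eqP => dimW; apply: Wfull; apply/eqP; rewrite eqEdim subvf /=.
  by rewrite dim_rowv dimW.
have {ME stW} stM x : (M *m R x <= M)%MS.
  apply/row_subP => i; rewrite row_mul ME; apply: stW; rewrite -ME; exact: row_sub.
have nE : n = (\dim W + (n - \dim W))%N by rewrite subnKC // ltnW.
move: (\dim W) (n - \dim W)%N nE M freeM stM W_gt0 Wltn => m1 m2 nE.
move: R repR PR {redR W W0 Wfull}; subst n => R repR PR M freeM stM m1_gt0 m2_gt0.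
have lt_m1 : (m1 < N)%N by apply: leq_trans m2_gt0 _.
have lt_m2 : (m2 < N)%N.
  apply: leq_trans (_ : m2 < m1 + m2)%N _ => //.
  by rewrite -[X in (X < _)%N]add0n ltn_add2r.
(* The first rows of [E] span the stable row space of [M], so conjugation by [E] makes every [R x]
   block triangular. *)
pose E := row_ebase M; have uE : E \in unitmx by apply: row_ebase_unit.
have [Y uY EM] : exists2 Y, Y \in unitmx & M = Y *m usubmx E.
  exists (col_ebase M); first exact: col_ebase_unit.
  rewrite -[LHS]mulmx_ebase -mulmxA; congr (_ *m _).
  rewrite -/E (eqP freeM) -[E in LHS]vsubmxK pid_mx_row mul_row_col mul0mx addr0.
  by rewrite mul1mx.
pose R' x := E *m R x *m invmx E.
have rep' : is_mxrep iota R' by apply: mxrep_conj.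
have R'0 x : ursubmx (R' x) = 0.
  have /submxP[X XM] := stM x.
  have : usubmx E *m R x = invmx Y *m X *m Y *m usubmx E.
    by apply: (can_inj (mulKmx uY)); rewrite !mulmxA -EM XM mulmxV // mul1mx -!mulmxA -EM.
  move=> UE; rewrite /ursubmx /R' -!mul_usub_mx UE -!mulmxA mul_usub_mx mulmxV //.
  rewrite -!mulmx_rsub; have -> : rsubmx (usubmx (1%:M : 'M[F]_(m1 + m2))) = 0.
    by rewrite scalar_mx_block -/(ursubmx _) block_mxKur.
  by rewrite !mulmx0.
have [rep1 rep2] := mxrep_lblock rep' R'0.
move: PR; rewrite -(char_poly_conj _ uE) -/(R' h) (char_poly_lblock (R'0 h)).
case/PM => [P1'|P2'].
  have [m [Q [/andP[m0 mle] ? ? ?]]] := IHN m1 _ lt_m1 rep1 P1'.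
  by exists m, Q; split=> //; rewrite m0 (leq_trans mle) // leq_addr.
have [m [Q [/andP[m0 mle] ? ? ?]]] := IHN m2 _ lt_m2 rep2 P2'.
by exists m, Q; split=> //; rewrite m0 (leq_trans mle) // leq_addl.
Qed.

End Constituent.

(** * Growth of a subspace under a family of operators *)

Section Grow.
Variables (F : fieldType) (V : vectType F) (r : nat) (phi : 'I_r -> 'End(V)).
Implicit Types (W : {vspace V}) (k : nat).

(** With [phi] the action of a basis of [g], this is [W + g W], the step from one term of the
    filtration to the next. *)
Definition grow W : {vspace V} := (W + \sum_i (phi i @: W))%VS.

Lemma grow_sub W : (W <= grow W)%VS.
Proof. exact: addvSl. Qed.

Lemma memv_grow W i w : w \in W -> phi i w \in grow W.
Proof.
move=> wW; apply: (subvP (addvSr _ _)).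
by apply: (subvP (sumv_sup i _ (subvv _))) => //; apply: memv_img.
Qed.

Lemma dim_grow W : (\dim (grow W) <= r.+1 * \dim W)%N.
Proof.
apply: leq_trans (dimv_add_leqif _ _).1 _; rewrite mulSn leq_add2l.
apply: leq_trans (dimv_leq_sum _ _ _) _.
apply: leq_trans (_ : _ <= \sum_(i < r) \dim W)%N _.
  by apply: leq_sum => i _; rewrite -(limg_ker_dim (phi i) W) leq_addl.
by rewrite sum_nat_const card_ord.
Qed.

Lemma dim_iter_grow k W : (\dim (iter k grow W) <= r.+1 ^ k * \dim W)%N.
Proof.
elim: k => [|k IHk]; first by rewrite mul1n.
apply: leq_trans (dim_grow _) _.
by rewrite expnS -mulnA leq_mul2l IHk orbT.
Qed.

Lemma iter_grow_ind (P : nat -> V -> Prop) W :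
    (forall k, P k 0) -> (forall k u v, P k u -> P k v -> P k (u + v)) ->
    (forall k u, P k u -> P k.+1 u) -> (forall k u i, P k u -> P k.+1 (phi i u)) ->
  (forall u, u \in W -> P 0 u) -> forall k u, u \in iter k grow W -> P k u.
Proof.
move=> P0 PD PS Pphi PW; elim=> [//|k IHk] u /=.
case/memv_addP => w wW [v /memv_sumP[f fW ->] ->]; apply: (PD).
  by apply/PS/IHk.
apply: big_ind => [||i _]; [exact: P0 | exact: PD |].
by have /memv_imgP[x xW ->] := fW i isT; apply/Pphi/IHk.
Qed.

(** Each iterate gains a dimension unless the growth has stopped, and a subspace at which it stops
    is stable under all [phi i], hence the whole space. *)
Lemma iter_grow_full W :
    (forall U : {vspace V}, (forall i w, w \in U -> phi i w \in U) ->
      U = 0%VS \/ U = fullv) ->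
  W <> 0%VS -> iter (\dim {:V}) grow W = fullv.
Proof.
move=> irr W0; have sub k : (W <= iter k grow W)%VS.
  by elim: k => [|k IHk]; [exact: subvv | exact: subv_trans IHk (grow_sub _)].
have [//|] : iter (\dim {:V}) grow W = fullv \/
    (\dim {:V} < \dim (iter (\dim {:V}) grow W))%N.
  move: (\dim {:V}) => k; elim: k => [|k [Wk|ltk]].
  - by right; rewrite lt0n dimv_eq0; apply/eqP.
  - by left; apply/eqP; rewrite eqEsubv subvf -[X in (X <= _)%VS]Wk; apply: grow_sub.
  have [gk|ngk] := eqVneq (iter k.+1 grow W) (iter k grow W).
    have [i w wW|k0|kfull] := irr (iter k grow W).
    - by rewrite -gk; apply: memv_grow.
    - by case: W0; apply/eqP; rewrite -subv0; rewrite -k0 sub.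
    - by left; rewrite gk.
  right; apply: leq_ltn_trans ltk _; rewrite ltn_neqAle dimvS ?grow_sub // andbT.
  apply: contra ngk => /eqP dimE; rewrite eq_sym eqEdim grow_sub /=.
  by rewrite dimE.
by rewrite ltnNge dimvS // subvf.
Qed.

End Grow.

(** * Sums of eigenvalues, and multiples that avoid finitely many values *)

Section Sums.
Variables (L : fieldType) (S : seq L).

(** Allowing 0 as a summand makes these the sums of at most [k] elements of [S], so the lists
    increase with [k]. *)
Fixpoint sums k : seq L :=
  if k is k'.+1 then [seq c + s | c <- sums k', s <- 0 :: S] else [:: 0].

Lemma sumsS k c s : c \in sums k -> s \in 0 :: S -> c + s \in sums k.+1.
Proof. by move=> ck sS; apply: allpairs_f. Qed.

Lemma leq_sums k l : (k <= l)%N -> {subset sums k <= sums l}.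
Proof.
move=> /subnK<- c ck; elim: (l - k)%N => //= n IHn.
by rewrite -[c]addr0 sumsS ?mem_head.
Qed.

Lemma sumsD k l c d : c \in sums k -> d \in sums l -> c + d \in sums (k + l).
Proof.
move=> ck; elim: l d => [|l IHl] d; first by rewrite inE => /eqP->; rewrite addr0 addn0.
by case/allpairsP=> -[d' s] /= [dl sS ->]; rewrite addrA addnS sumsS ?IHl.
Qed.

Lemma sum_translates a m t : {subset t <= [seq a + c | c <- sums m]} ->
  exists2 c, c \in sums (size t * m) & \sum_(x <- t) x = (size t)%:R * a + c.
Proof.
elim: t => [|x t IHt] tS; first by exists 0; rewrite ?inE // big_nil mul0r addr0.
have [|c cS E] := IHt; first by move=> y yt; apply: tS; rewrite inE yt orbT.
have /mapP[d dS xE] := tS x (mem_head _ _).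
exists (d + c); first by rewrite mulSn sumsD.
by rewrite big_cons E xE [in RHS]/= -natr1 mulrDl mul1r addrACA [a + _]addrC.
Qed.

Lemma killed_sumsS (V : lmodType L) (f : V -> V) A k x :
    killed f [seq t + s | t <- [seq a + c | a <- A, c <- sums k], s <- 0 :: S] x ->
  killed f [seq a + c | a <- A, c <- sums k.+1] x.
Proof.
apply: killed_sub => _ /allpairsP[[t s] /= [/allpairsP[[a c] /= [aA cS ->]] sS ->]].
by rewrite -addrA allpairs_f ?sumsS.
Qed.

End Sums.

(** In characteristic 0 each pair with nonzero first entry excludes at most one [n]. *)
Lemma nat_avoids (L : fieldType) (s : seq (L * L)) : [pchar L] =i pred0 ->
    (forall ab, ab \in s -> ab.1 != 0) ->
  exists N, forall n ab, (N <= n)%N -> ab \in s -> n%:R * ab.1 + ab.2 != 0.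
Proof.
move=> char0; elim: s => [|[a b] s IHs] s0; first by exists 0.
have [|N HN] := IHs; first by move=> ab abs; apply: s0; rewrite inE abs orbT.
have a0 := s0 (a, b) (mem_head _ _).
have [[m /eqP mab]|nab] := classic (exists m, m%:R * a + b == 0).
  exists (maxn N m.+1) => n ab; rewrite geq_max inE => /andP[Nn mn].
  case/orP=> [/eqP->/=|]; last exact: HN.
  apply/eqP => nab; have: (n - m)%:R * a == 0.
    by rewrite natrB 1?ltnW // mulrBl -[_ - _](addrKA b) nab [b + _]addrC mab subrr.
  by rewrite mulf_eq0 (negPf a0) orbF (proj1 (pcharf0P L) char0) subn_eq0 leqNgt mn.
exists N => n ab Nn; rewrite inE => /orP[/eqP->/=|]; last exact: HN.
by apply/negP => n0; apply: nab; exists n.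
Qed.

(** * A relation between the dimension and the eigenvalues of an irreducible representation *)

Section DimBound.
Variables (K L : fieldType) (iota : {rmorphism K -> L}) (g : lieAlgType K).
Variables (h : g) (S : seq L).
Hypothesis DS : map_poly iota (char_poly (ad_mx h)) = \prod_(s <- S) ('X - s%:P).

Lemma killed_mxrep_grow n (R : g -> 'M[L]_n) A k (u : 'rV_n) x : is_mxrep iota R ->
    killed (mulmxr (R h)) [seq a + c | a <- A, c <- sums S k] u ->
  killed (mulmxr (R h)) [seq a + c | a <- A, c <- sums S k.+1] (u *m R x).
Proof.
move=> repR uk; apply: killed_sumsS; apply: killed_sub (killed_mxrep x repR DS uk).
move=> _ /allpairsP[ts [tT sS ->]]; apply/allpairsP; exists ts; split=> //.
by rewrite inE sS orbT.
Qed.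

Lemma killed_grow n (f : 'rV[L]_n -> 'rV[L]_n) A k (u : 'rV_n) :
    killed f [seq a + c | a <- A, c <- sums S k] u ->
  killed f [seq a + c | a <- A, c <- sums S k.+1] u.
Proof.
apply: killed_sub => _ /allpairsP[[a c] /= [aA cS ->]].
by rewrite allpairs_f // (leq_sums (leqnSn k)).
Qed.

Definition mxrep_hom (F : fieldType) n (R : g -> 'M[F]_n) i : 'End('rV[F]_n) :=
  linfun (mulmxr (R (lie_basis i))).

(* All eigenvalues of [R h] are [a + c] with [c] in [sums S n], and [R h] is
   traceless. *)
Lemma eigenvalue_bound n (R : g -> 'M[L]_n) a :
    is_mxrep iota R -> mxirreducible R -> h \in bracketv {:g} {:g} ->
  eigenvalue (R h) a -> exists2 c, c \in sums S (n * n) & n%:R * a + c = 0.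
Proof.
move=> repR irrR hg /eigenvalueP[w wh w0].
(* By irreducibility the eigenline of [w] grows to the whole space in [n] steps, and each step
   shifts eigenvalues of [h] by at most one eigenvalue of [ad h]. *)
pose W k := iter k (grow (mxrep_hom R)) <[w]>%VS.
have Wfull : W n = fullv.
  have := @iter_grow_full _ _ _ (mxrep_hom R) <[w]>%VS.
  rewrite dim_rowv; apply; last first.
    by apply/eqP; rewrite -dimv_eq0 dim_vline w0.
  move=> U stU; apply: irrR => x u uU.
  rewrite (mxrep_basisE repR) mulmx_sumr; apply: memv_suml => i _.
  by rewrite -scalemxAr memvZ //; have := stU i u uU; rewrite lfunE.
pose P k (u : 'rV_n) :=
  killed (mulmxr (R h)) [seq a' + c | a' <- [:: a], c <- sums S k] u.
have Wk k u : u \in W k -> P k u.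
  apply: (@iter_grow_ind _ _ _ (mxrep_hom R) P <[w]>%VS).
  - by move=> ?; apply: killed0.
  - by move=> ? ? ?; apply: killedD.
  - by move=> ? ?; apply: killed_grow.
  - by move=> ? v i; rewrite lfunE; apply: killed_mxrep_grow.
  move=> _ /vlineP[b ->]; apply: killedZ; exists [:: a].
    by move=> t; rewrite /= addr0.
  by rewrite /= wh subrr.
have [|t tS [szt trE]] := @trace_killed _ _ (R h) [seq a' + c | a' <- [:: a], c <- sums S n].
  by move=> u; apply: Wk; rewrite Wfull memvf.
have [|c cS tE] := @sum_translates _ S a n t.
  by move=> x /tS; rewrite /= cats0.
rewrite szt in cS tE; exists c => //.
by rewrite -tE -trE (mxtrace_bracketv repR).
Qed.

End DimBound.

(** * Tensor powers of the adjoint representation, and passage from matrices to linear maps *)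

Section ScalarRep.
Variables (K : fieldType) (g : lieAlgType K).

Notation is_krep := (is_mxrep (idfun : {rmorphism K -> K})).

Lemma ad_mxrep : is_krep (@ad_mx K g).
Proof.
have eqR (A B : 'M[K]_(dim g)) : (forall y : g, v2r y *m A = v2r y *m B) -> A = B.
  by move=> AB; apply/row_matrixP => i; rewrite !rowE -[delta_mx 0 i]r2vK.
split=> [a x y|x y]; apply: eqR => z.
  by rewrite mulmxDr -scalemxAr !ad_mxE bracket_linearl linearP.
by rewrite mulmxBr !mulmxA !ad_mxE bracketA linearB.
Qed.

Lemma mxrep_map (L : fieldType) (iota : {rmorphism K -> L}) n (R : g -> 'M[K]_n) :
  is_krep R -> is_mxrep iota (fun x => map_mx iota (R x)).
Proof.
move=> [linR brR]; split=> [a x y|x y]; first by rewrite linR map_mxD map_mxZ.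
by rewrite brR map_mxB !map_mxM.
Qed.

Lemma multiple_eigenvalue (L : fieldType) (iota : {rmorphism K -> L}) (h : g) a n :
    eigenvalue (map_mx iota (ad_mx h)) a ->
  exists d (R : g -> 'M[K]_d),
    is_krep R /\ eigenvalue (map_mx iota (R h)) (n%:R * a).
Proof.
move=> ha; elim: n => [|n [d [R [repR Rn]]]].
  (* The empty tensor power is the trivial one-dimensional representation, on which [h] has the
     eigenvalue 0. *)
  exists 1, (fun=> 0); split.
    by split=> *; rewrite /= ?scaler0 ?mulmx0 ?addr0 ?subrr.
  apply/eigenvalueP; exists 1; last exact: oner_neq0.
  by rewrite map_mx0 mulmx0 mul0r scale0r.
exists (d * dim g)%N, (tensor_mx R (@ad_mx K g)); split.
  by apply: tensor_mxrep => //; apply: ad_mxrep.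
by rewrite -natr1 mulrDl mul1r; apply: tensor_eigenvalue.
Qed.

Definition row_action n (R : g -> 'M[K]_n) x : 'End('rV[K]_n) := linfun (mulmxr (R x)).

Lemma row_action_is_linear n (R : g -> 'M[K]_n) : is_krep R -> linear (row_action R).
Proof.
move=> [linR _] a x y; apply/lfunP => u.
by rewrite add_lfunE scale_lfunE !lfunE /= linR mulmxDr scalemxAr.
Qed.

Definition rep_of n (R : g -> 'M[K]_n) (repR : is_krep R) : 'Hom(g, 'End('rV[K]_n)) :=
  linfun (HB.pack (row_action R)
    (GRing.isLinear.Build _ _ _ _ (row_action R) (row_action_is_linear repR))
    : {linear g -> 'End('rV[K]_n)}).

Lemma rep_ofE n (R : g -> 'M[K]_n) (repR : is_krep R) x u : rep_of repR x u = u *m R x.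
Proof. by rewrite /rep_of lfunE /= lfunE. Qed.

Lemma rep_of_irreducible n (R : g -> 'M[K]_n) (repR : is_krep R) :
  (0 < n)%N -> mxirreducible R -> irreducible_rep (rep_of repR).
Proof.
move=> n_gt0 irrR; split.
- move=> x y; apply/lfunP => u.
  by rewrite add_lfunE opp_lfunE !comp_lfunE !rep_ofE (proj2 repR) mulmxBr !mulmxA.
- move/(congr1 (fun W : {vspace _} => \dim W)); rewrite dim_rowv dimv0 => n0.
  by rewrite n0 in n_gt0.
- by move=> W stW; apply: irrR => x w /(stW x); rewrite rep_ofE.
Qed.

End ScalarRep.

(** * Existence of the jet-order, and jet-filtrations from chains of subspaces *)

Section JetOrder.
Variables (K : fieldType) (g : lieAlgType K) (V : vectType K).
Variable rho : 'Hom(g, 'End(V)).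

Lemma size_proper_path (s : seq {vspace V}) U :
  path (@proper_subv K V) U s -> (\dim U + size s <= \dim {:V})%N.
Proof.
elim: s U => [|W s IHs] U /=; first by rewrite addn0 dimvS ?subvf.
case/andP=> /andP[UW neqUW] /IHs; apply: leq_trans.
rewrite addnS -addSn leq_add2r ltn_neqAle dimvS // andbT.
by apply: contra neqUW => /eqP dimE; rewrite eqEdim UW dimE /=.
Qed.

(** Lengths are bounded by the dimension, and a longest jet-filtration is maximally refined since an
    insertion would lengthen it. *)
Lemma jet_order_exists s : jet_filtration rho s ->
  exists2 m, is_jet_order rho m & (size s <= m)%N.
Proof.
move=> jet_s.
have [||t jet_t max_t] := @maximal_exists _ (jet_filtration rho) size (\dim {:V}).
- by exists s.
- move=> t [/size_proper_path]; rewrite dimv0 size_rcons add0n => lt_t _.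
  exact: ltnW.
exists (size t); last exact: max_t.
split; last by move=> ? ? _; apply: max_t.
exists t; split=> // s1 s2 U tE /max_t.
by rewrite tE !size_cat /= addnS ltnn.
Qed.

(** As [h] maps [U i] injectively into itself, every vector of [U i] is a value [rho h w] with [w]
    in [U i]. Being neither 0 nor the whole space, [U i] is not stable under [g], which gives the
    strictness conditions. *)
Lemma jet_filtration_mkseq (h : g) (U : nat -> {vspace V}) k :
    irreducible_rep rho -> U 0 <> 0%VS ->
    (forall i, (i <= k)%N -> U i <> fullv) ->
    (forall i, (i < k)%N -> (U i <= U i.+1)%VS) ->
    (forall i x w, (i < k)%N -> w \in U i -> rho x w \in U i.+1) ->
    (forall i w, (i <= k)%N -> w \in U i -> rho h w \in U i) ->
    (forall i w, (i <= k)%N -> w \in U i -> rho h w = 0 -> w = 0) ->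
  jet_filtration rho (mkseq U k.+1).
Proof.
move=> [_ _ irr] U0 Ufull Usub Ug Uh injh.
have UNstab i : (i <= k)%N -> exists x, exists2 w, w \in U i & rho x w \notin U i.
  move=> ik; apply: NNPP => nex.
  have [x w wU|Ui0|/(Ufull i ik)//] := irr (U i).
    by apply: NNPP => /negP nU; apply: nex; exists x, w.
  case: U0; apply/eqP; rewrite -subv0 -Ui0; elim: i ik {nex Ui0} => // i IHi ik.
  exact: subv_trans (IHi (ltnW ik)) (Usub i ik).
have Uproper i : (i < k)%N -> proper_subv (U i) (U i.+1).
  move=> ik; rewrite /proper_subv Usub //=; apply/eqP => UE.
  have [x [w wU]] := UNstab i (ltnW ik); case/negP.
  by rewrite UE; apply: Ug.
have nthE x0 i : (i <= k)%N -> nth x0 (mkseq U k.+1) i = U i.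
  by move=> ik; rewrite nth_mkseq.
move: (mkseq U k.+1) (size_mkseq U k.+1) nthE => s sz nthE.
split.
  apply/(pathP 0%VS) => i; rewrite size_rcons sz ltnS => ik.
  case: i ik => [_|i ik].
    by rewrite nth_rcons sz nthE // /proper_subv sub0v /= eq_sym; apply/eqP.
  rewrite -[nth _ (_ :: _) _]/(nth 0%VS (rcons s fullv) i) !nth_rcons sz ik nthE //.
  move: ik; rewrite ltnS leq_eqVlt ltnS.
  case/orP=> [/eqP->|ik].
    by rewrite ltnn eqxx /proper_subv subvf /=; apply/eqP/Ufull.
  by rewrite ik nthE // Uproper.
move=> i; rewrite sz => ik; rewrite !(nthE _ i) //; split.
- move=> v vU; have : v \in (rho h @: U i)%VS.
    suff /eqP-> : (rho h @: U i == U i)%VS by [].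
    rewrite eqEdim; apply/andP; split.
      by apply/subvP => _ /memv_imgP[w wU ->]; apply: Uh.
    rewrite limg_dim_eq //; apply/eqP; rewrite -subv0; apply/subvP => w.
    rewrite memv_cap memv_ker memv0 => /andP[wU /eqP hw0]; apply/eqP.
    exact: (injh i w ik wU hw0).
  by case/memv_imgP=> w wU ->; exists h, w.
- have [x [w wU xw]] := UNstab i ik.
  by exists (rho x w) => //; exists x, w.
- move=> _ [x [w wU ->]]; move: ik; rewrite ltnS leq_eqVlt => /orP[/eqP->|ik].
    (* Past the last term [U k], [nth] yields its default, the whole space. *)
    by rewrite nth_default ?sz // memvf.
  by rewrite nthE //; apply: Ug.
Qed.

End JetOrder.

(** * Cyclic subspaces annihilated by a polynomial *)

Section Cyclic.
Variables (K L : fieldType) (iota : {rmorphism K -> L}) (n : nat).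

Lemma horner_mx_eigen (F : fieldType) (H : 'M[F]_n.+1) (u : 'rV_n.+1) a (p : {poly F}) :
  u *m H = a *: u -> root p a -> u *m horner_mx H p = 0.
Proof.
move=> uH /factor_theorem[q ->]; rewrite mulrC rmorphM /= mulmxA.
by rewrite rmorphB /= horner_mx_X horner_mx_C mulmxBr uH mul_mx_scalar subrr mul0mx.
Qed.

Lemma prodsub_scale (F : fieldType) (H : 'M[F]_n) b (ts : seq F) (u : 'rV_n) :
  prodsub (mulmxr (b *: H)) [seq b * t | t <- ts] u =
  b ^+ size ts *: prodsub (mulmxr H) ts u.
Proof.
elim: ts u => [|t ts IH] u; first by rewrite scale1r.
rewrite /= IH -scalemxAr -scalerA -scalerBr prodsubZ scalerA.
by rewrite exprSr.
Qed.

(** [W] consists of the vectors [v *m horner_mx H q] for a nonzero [v] annihilated by [p]; reducing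
    [q] modulo [p] bounds its dimension by the degree of [p]. *)
Lemma cyclic_subspace (H : 'M[K]_n.+1) (p : {poly K}) (A : seq L) :
    p != 0 -> map_poly iota p %= \prod_(a <- A) ('X - a%:P) ->
    (exists2 a, a \in A & eigenvalue (map_mx iota H) a) ->
  exists W : {vspace 'rV[K]_n.+1}, [/\ W <> 0%VS, (\dim W <= (size p).-1)%N,
    forall w, w \in W -> w *m H \in W &
    forall w, w \in W -> killed (mulmxr (map_mx iota H)) A (map_mx iota w)].
Proof.
move=> p0 pA [a aA /eigenvalueP[u uH u0]].
(* The given eigenvector lives over [L], but singularity of [horner_mx H p] descends to [K]. *)
have [v vp v0] : exists2 v : 'rV_n.+1, v *m horner_mx H p = 0 & v != 0.
  have : eigenpoly H p.
    rewrite -(eigenpoly_map iota); apply/eigenpolyP; exists u => //.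
    apply/sub_kermxP; apply: horner_mx_eigen uH _.
    by rewrite (eqp_root pA) root_prod_XsubC.
  by case/eigenpolyP=> v /sub_kermxP vp v0; exists v.
pose f : 'Hom('rV[K]_((size p).-1), 'rV[K]_n.+1) :=
  linfun (mulmx v \o horner_mx H \o rVpoly).
have fE q : v *m horner_mx H q \in limg f.
  have -> : v *m horner_mx H q = f (poly_rV (q %% p)).
    rewrite lfunE /= poly_rV_K; last first.
      by rewrite -ltnS prednK ?ltn_modp // size_poly_gt0.
    rewrite {1}(divp_eq q p) rmorphD mulrC rmorphM /= mulmxDr mulmxA vp mul0mx.
    by rewrite add0r.
  exact: memv_img (memvf _).
have fP w : w \in limg f -> exists q, w = v *m horner_mx H q.
  by case/memv_imgP=> q _ ->; rewrite lfunE; exists (rVpoly q).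
exists (limg f); split.
- by move=> f0; have := fE 1; rewrite rmorph1 mulmx1 f0 memv0 (negPf v0).
- by rewrite -[X in (_ <= X)%N](dim_rowv K) -(limg_ker_dim f) leq_addl.
- move=> _ /fP[q ->]; rewrite -mulmxA -[X in _ *m X]/(horner_mx H q * H).
  by rewrite -[X in _ * X](horner_mx_X H) -rmorphM fE.
move=> _ /fP[q ->]; exists A => //; rewrite -horner_prodsub.
have /eqpP[[c1 c2] /= /andP[c1_0 c2_0] cE] := pA.
apply: (scalerI c2_0); rewrite scaler0 scalemxAr -horner_mxZ -cE horner_mxZ.
rewrite -scalemxAr -map_horner_mx -map_mxM -mulmxA.
have -> : horner_mx H q *m horner_mx H p = horner_mx H p *m horner_mx H q.
  by rewrite -[LHS]rmorphM mulrC rmorphM.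
by rewrite mulmxA vp mul0mx map_mx0 scaler0.
Qed.

End Cyclic.

(** * Construction of the representation and of its long jet-filtration *)

Section Main.
Variables (K : fieldType) (g : lieAlgType K).

Lemma ad_mx_nilpotent (h : g) : char_poly (ad_mx h) = 'X^(dim g) ->
  forall y, iter (dim g) (bracket h) y = 0.
Proof.
move=> ch y; apply: (can_inj v2rK); rewrite linear0.
have iterE m : v2r (iter m (bracket h) y) = iter m (mulmxr (ad_mx h)) (v2r y).
  by elim: m => //= m <-; rewrite ad_mxE.
rewrite iterE; move: (ad_mx h) (v2r y) ch; case: (dim g) => [|r] D v ch.
  by rewrite /= [v]thinmx0.
have iterX m : iter m (mulmxr D) v = v *m horner_mx D 'X^m.
  elim: m => [|m IHm]; first by rewrite rmorph1 mulmx1.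
  by rewrite exprSr rmorphM /= mulmxA IHm horner_mx_X.
by rewrite iterX -ch Cayley_Hamilton mulmx0.
Qed.

(** If every root of the characteristic polynomial were 0, it would be a power of ['X], and [ad h]
    would be nilpotent by the Cayley-Hamilton theorem. *)
Lemma ad_eigenvalue (h : g) : (exists y, forall N, iter N (bracket h) y <> 0) ->
  exists (L : fieldType) (iota : {rmorphism K -> L}) (S : seq L) (a : L),
    [/\ map_poly iota (char_poly (ad_mx h)) = \prod_(s <- S) ('X - s%:P),
        a \in S & a != 0].
Proof.
move=> [y hy]; have [L [iota [S DS]]] := splitting_field_exists (char_poly_monic (ad_mx h)).
exists L, iota, S; have [/hasP[a aS a0]|/hasPn S0] := boolP (has (fun a => a != 0) S).
  by exists a.
case: (hy (dim g)); apply: ad_mx_nilpotent.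
apply: (map_poly_inj iota); rewrite DS map_polyXn.
have szS : size S = dim g.
  have := congr1 (fun p : {poly L} => size p) DS.
  by rewrite size_map_poly size_char_poly size_prod_XsubC => -[].
rewrite (eq_big_seq (fun=> 'X)); last first.
  by move=> a /S0; rewrite negbK => /eqP->; rewrite subr0.
by rewrite big_const_seq count_predT szS iter_mulr_1.
Qed.

(** Dividing [p] by the largest power of ['X] in it keeps exactly the nonzero roots, and keeps the
    coefficients in [K], as needed to find a subspace over [K]. *)
Lemma nonzero_eigenvalue_factor (L : fieldType) (iota : {rmorphism K -> L})
    (p : {poly K}) (S : seq L) a :
    p \is monic -> map_poly iota p = \prod_(s <- S) ('X - s%:P) ->
    a \in S -> a != 0 ->
  exists (q : {poly K}) (A : seq L), [/\ q != 0, (size q <= size p)%N,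
    map_poly iota q %= \prod_(s <- A) ('X - s%:P), a \in A &
    forall b, b \in A -> b \in S /\ b != 0].
Proof.
move=> mon_p pS aS a0; have p0 := monic_neq0 mon_p.
have [m [q]] := multiplicity_XsubC p 0; rewrite p0 subr0 /= => q0 pE.
have qn0 : q != 0 by apply: contraNneq p0 => q_0; rewrite pE q_0 mul0r.
have mapE : map_poly iota p = map_poly iota q * 'X^m.
  by rewrite pE rmorphM /= map_polyXn.
have /dvdp_prod_XsubC[mk qA] : map_poly iota q %| \prod_(s <- S) ('X - s%:P).
  by rewrite -pS mapE dvdp_mulr.
exists q, (mask mk S); split=> //.
- by rewrite dvdp_leq // pE dvdp_mulr.
- rewrite -root_prod_XsubC -(eqp_root qA).
  have : root (map_poly iota p) a by rewrite pS root_prod_XsubC.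
  rewrite mapE rootM => /orP[//|]; case: (m) => [|m'].
    by rewrite expr0 rootE hornerC oner_eq0.
  by rewrite /root hornerXn expf_eq0 (negPf a0).
move=> b bA; split; first exact: mem_mask bA.
apply: contraNneq q0 => b0; rewrite -(fmorph_root iota) rmorph0 -b0.
by rewrite (eqp_root qA) root_prod_XsubC.
Qed.


Lemma long_jet_filtration k : [pchar K] =i pred0 -> semisimple_lie g ->
  exists (V : vectType K) (rho : 'Hom(g, 'End(V))) (s : seq {vspace V}),
    [/\ irreducible_rep rho, jet_filtration rho s & (k < size s)%N].
Proof.
move=> charK0 /semisimple_nonnilpotent[h hgg].
move=> /ad_eigenvalue[L [iota [S [a [DS aS a0]]]]].
have charL0 : [pchar L] =i pred0 by move=> p; rewrite (fmorph_pchar iota).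
have [q [A [q0 szq qA aA AS]]] :=
  nonzero_eigenvalue_factor (char_poly_monic _) DS aS a0.
rewrite size_char_poly in szq.
(* Bounds the terms of the filtration: the first has dimension at most [dim g], and each growth step
   multiplies the dimension by at most [dim g + 1]. *)
pose B := ((dim g).+1 ^ k * dim g)%N.
(* The trace relation in dimension at most [B] involves sums of at most [B * B] eigenvalues, the
   filtration sums of at most [k]. *)
pose M := maxn (B * B) k.
(* [e] is the dimension in the trace relation and 1 for the filtration; the range up to [B.+1]
   contains 1 whatever [B] is. *)
pose mults := [seq e%:R * b | e <- seq.iota 1 B.+1, b <- A].
pose bad := [seq (eb, c) | eb <- mults, c <- sums S M].
have [|N HN] := @nat_avoids L bad charL0.
  move=> _ /allpairsP[[eb c] [/allpairsP[[e b] [e1 bA ->]] _ ->]] /=.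
  rewrite mulf_neq0 //; last by have [] := AS b bA.
  by rewrite (proj1 (pcharf0P L) charL0) -lt0n; move: e1; rewrite mem_iota => /andP[].
(* The successor makes [n] nonzero, so that division by it is possible. *)
pose n := N.+1.
have good e b c : (0 < e <= B.+1)%N -> b \in A -> c \in sums S M ->
    n%:R * (e%:R * b) + c != 0.
  move=> eB bA cS; apply: (HN n (e%:R * b, c)) => //.
  by apply: allpairs_f => //; apply: allpairs_f => //; rewrite mem_iota.
have n0 : (n%:R : K) != 0 by rewrite (proj1 (pcharf0P K) charK0).
have ha : eigenvalue (map_mx iota (ad_mx h)) a.
  by rewrite eigenvalue_root_char -map_char_poly DS root_prod_XsubC.
have [d0 [R0 [rep0 eig0]]] := multiple_eigenvalue n ha.
pose P (p : {poly L}) := root p (n%:R * a).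
have PM p p' : P (p * p') -> P p \/ P p' by rewrite /P rootM => /orP.
have P1 : ~ P 1 by rewrite /P rootE hornerC oner_eq0.
(* The constituent is taken over [K], although the eigenvalue lies in [L]: the characteristic
   polynomial is tested after mapping it to [L]. *)
have [|||d [R [/andP[d_gt0 _] repR irrR Rroot]]] :=
    irreducible_constituent (h := h) (P := P \o map_poly iota) _ _ rep0.
- by move=> p p' /=; rewrite rmorphM; apply: PM.
- by rewrite /= rmorph1.
- by rewrite /= map_char_poly /P -eigenvalue_root_char.
rewrite /= map_char_poly in Rroot.
have repRL := mxrep_map iota repR.
have dB : (B < d)%N.
  rewrite ltnNge; apply/negP => dB.
  (* Irreducibility over [K] can be lost over [L], so a second constituent is taken over [L]; in
     dimension at most [B] the trace relation contradicts the choice of [n]. *)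
  have [m [R' [/andP[m_gt0 md] rep' irr' root']]] :=
    irreducible_constituent PM P1 repRL Rroot.
  have [|c cS] := eigenvalue_bound DS rep' irr' hgg (a := n%:R * a).
    by rewrite eigenvalue_root_char.
  have mB := leq_trans md dB.
  move/eqP; rewrite mulrCA; apply/negP; apply: good => //.
    by rewrite m_gt0 leqW.
  by apply: leq_sums cS; rewrite leq_max leq_mul.
case: d d_gt0 R repR irrR Rroot repRL dB => // d _ R repR irrR Rroot repRL dB.
(* Division by [n] turns the eigenvalue [n a] into the root [a] of [q], which does not depend on
   [n]; so [W] has dimension at most [dim g]. *)
pose H := n%:R^-1 *: R h.
have RhE : R h = n%:R *: H by rewrite scalerA mulfV // scale1r.
have nL0 : (n%:R : L) != 0 by rewrite (proj1 (pcharf0P L) charL0).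
have [|W [W0 dimW WH killedW]] := cyclic_subspace (H := H) q0 qA.
  exists a => //; move: Rroot; rewrite /P -eigenvalue_root_char RhE map_mxZ rmorph_nat.
  case/eigenvalueP=> u uH u0; apply/eigenvalueP; exists u => //.
  by apply: (scalerI nL0); rewrite scalemxAr uH scalerA.
pose U i := iter i (grow (mxrep_hom R)) W.
have Ug i x w : w \in U i -> w *m R x \in U i.+1.
  move=> wU; rewrite (mxrep_basisE repR) mulmx_sumr; apply: memv_suml => j _.
  rewrite -scalemxAr memvZ //=; have := memv_grow (mxrep_hom R) j wU.
  by rewrite lfunE.
have Usub i : (U i <= U i.+1)%VS by apply: grow_sub.
have Uh i w : w \in U i -> w *m R h \in U i.
  pose Q i (w : 'rV_d.+1) := w \in U i /\ w *m R h \in U i.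
  suff /[apply] : forall i w, w \in U i -> Q i w by case.
  apply: (@iter_grow_ind _ _ _ (mxrep_hom R) Q).
  - by move=> ?; split; rewrite ?mul0mx mem0v.
  - by move=> ? u v [? ?] [? ?]; split; rewrite ?mulmxDl memvD.
  - by move=> j u [uU uhU]; split; apply: (subvP (Usub j)).
  - move=> j u l [uU uhU]; rewrite lfunE /=; split; first exact: Ug.
    have -> : u *m R (lie_basis l) *m R h =
        u *m R h *m R (lie_basis l) + u *m R (bracket h (lie_basis l)).
      by rewrite (proj2 repR) mulmxBr !mulmxA addrC subrK.
    by rewrite memvD ?Ug.
  move=> u uW; split=> //; rewrite RhE -scalemxAr.
  by apply: memvZ; apply: WH.
have Ukilled i w : w \in U i -> killed (mulmxr (map_mx iota (R h)))
    [seq b + c | b <- [seq n%:R * b | b <- A], c <- sums S i] (map_mx iota w).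
  pose Q i (w : 'rV_d.+1) := killed (mulmxr (map_mx iota (R h)))
    [seq b + c | b <- [seq n%:R * b | b <- A], c <- sums S i] (map_mx iota w).
  apply: (@iter_grow_ind _ _ _ (mxrep_hom R) Q).
  - by move=> ?; rewrite /Q map_mx0; apply: killed0.
  - by move=> ? ? ? ? ?; rewrite /Q map_mxD; apply: killedD.
  - by move=> ? ?; apply: killed_grow.
  - move=> j u l; rewrite /Q lfunE /= map_mxM.
    exact: (killed_mxrep_grow DS _ repRL).
  move=> u /killedW[ts tsA uts]; exists [seq n%:R * t | t <- ts].
    move=> _ /mapP[t /tsA tA ->]; rewrite -[_ * t]addr0.
    by apply: allpairs_f; [apply: map_f | rewrite inE].
  by rewrite RhE map_mxZ rmorph_nat prodsub_scale uts scaler0.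
exists 'rV[K]_d.+1, (rep_of repR), (mkseq U k.+1); split.
- exact: rep_of_irreducible.
- apply: (@jet_filtration_mkseq _ _ _ _ h) => //.
  + exact: rep_of_irreducible.
  + move=> i ik Ufull; move: dB; rewrite -[X in (_ < X)%N](dim_rowv K) -Ufull ltnNge.
    apply/negP; rewrite negbK; apply: leq_trans (dim_iter_grow _ _ _) _.
    rewrite /B leq_mul // ?leq_pexp2l //; apply: leq_trans dimW _.
    by case: (size q) szq.
  + by move=> i x w _ wU; rewrite rep_ofE Ug.
  + by move=> i w _ wU; rewrite rep_ofE Uh.
  move=> i w ik wU; rewrite rep_ofE => wh0; apply/eqP/negPn/negP => w0.
  (* A nonzero vector killed by [h] would make 0 one of the values [n b + c], which [good] excludes
     with [e = 1]. *)
  have : 0 \in [seq b + c | b <- [seq n%:R * b | b <- A], c <- sums S i].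
    apply: killed_eigen (Ukilled i w wU); last by rewrite map_mx_eq0.
    by rewrite /= -map_mxM wh0 map_mx0 scale0r.
  case/allpairsP=> -[_ c] /= [/mapP[b bA ->] cS] /esym/eqP; apply/negP.
  have := @good 1%N b c; rewrite mul1r; apply=> //.
  by apply: leq_sums cS; rewrite leq_max ik orbT.
by rewrite size_mkseq.
Qed.

End Main.

Local Close Scope ring_scope.

Theorem proposition4 (K : fieldType) (charK0 : [pchar K]%R =i pred0)
    (g : lieAlgType K) (hg : semisimple_lie g) (k : nat) (hk : 0 < k) :
  exists (V : vectType K) (rho : 'Hom(g, 'End(V))),
    irreducible_rep rho /\ exists m : nat, is_jet_order rho m /\ k < m.
Proof.
have [V [rho [s [irr_rho jet_s lt_ks]]]] := long_jet_filtration k charK0 hg.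
have [m jet_m le_sm] := jet_order_exists jet_s.
by exists V, rho; split=> //; exists m; split=> //; apply: leq_trans lt_ks le_sm.
Qed.
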